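(* Let $(M,\tilde\varphi,\xi,\eta,\tilde g)$ be a paracontact $(\tilde\kappa,\tilde\mu)$-manifold with $\tilde\kappa>-1$, and set $\tilde\lambda=\sqrt{1+\tilde\kappa}$; assume the index of $\mathcal D_{\tilde h}(\pm\tilde\lambda)$ is constant on $M$. Then for any $X,X',X''\in\mathcal D_{\tilde h}(\tilde\lambda)$ and $Y,Y',Y''\in\mathcal D_{\tilde h}(-\tilde\lambda)$: $$\tilde R_{XX'}X''=(2(\tilde\lambda-1)+\tilde\mu)\bigl(\tilde g(X',X'')X-\tilde g(X,X'')X'\bigr),$$ $$\tilde R_{XX'}Y=(\tilde\kappa+\tilde\mu)\bigl(-\tilde g(\tilde\varphi X',Y)\tilde\varphi X+\tilde g(\tilde\varphi X,Y)\tilde\varphi X'\bigr),$$ $$\tilde R_{XY}X'=\tilde\kappa\,\tilde g(\tilde\varphi Y,X')\tilde\varphi X-\tilde\mu\,\tilde g(\tilde\varphi Y,X)\tilde\varphi X',$$ $$\tilde R_{XY}Y'=-\tilde\kappa\,\tilde g(\tilde\varphi X,Y')\tilde\varphi Y+\tilde\mu\,\tilde g(\tilde\varphi X,Y)\tilde\varphi Y',$$ $$\tilde R_{YY'}X=(\tilde\kappa+\tilde\mu)\bigl(-\tilde g(\tilde\varphi Y',X)\tilde\varphi Y+\tilde g(\tilde\varphi Y,X)\tilde\varphi Y'\bigr),$$ $$\tilde R_{YY'}Y''=(-2(\tilde\lambda+1)+\tilde\mu)\bigl(\tilde g(Y',Y'')Y-\tilde g(Y,Y'')Y'\bigr).$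$
   Context: Conventions: $2d\eta(X,Y)=X(\eta(Y))-Y(\eta(X))-\eta([X,Y])$; $\tilde R_{XY}Z=\tilde\nabla_X\tilde\nabla_YZ-\tilde\nabla_Y\tilde\nabla_XZ-\tilde\nabla_{[X,Y]}Z$ with $\tilde\nabla$ the Levi-Civita connection of $\tilde g$. An almost paracontact structure on a $(2n+1)$-dimensional manifold $M$ is $(\tilde\varphi,\xi,\eta)$, with $\tilde\varphi$ a $(1,1)$-tensor field, $\xi$ a vector field, $\eta$ a 1-form, such that $\eta(\xi)=1$, $\tilde\varphi^2=I-\eta\otimes\xi$ and the $\pm1$-eigendistributions of $\tilde\varphi$ on $\mathcal D=\ker\eta$ both have dimension $n$. With a pseudo-Riemannian metric $\tilde g$ satisfying $\tilde g(\tilde\varphi X,\tilde\varphi Y)=-\tilde g(X,Y)+\eta(X)\eta(Y)$ and $d\eta(X,Y)=\tilde g(X,\tilde\varphi Y)$ it is a paracontact metric structure. Put $\tilde h=\frac12\mathcal L_\xi\tilde\varphi$. A paracontact $(\tilde\kappa,\tilde\mu)$-manifold ($\tilde\kappa,\tilde\mu$ real constants) is a paracontact metric manifold whose curvature tensor satisfies $\tilde R_{XY}\xi=\tilde\kappa(\eta(Y)X-\eta(X)Y)+\tilde\mu(\eta(Y)\tilde hX-\eta(X)\tilde hY)$ for all vector fields $X,Y$. When $\tilde\kappa>-1$, $\tilde h$ is diagonalizable with eigenvalues $0$ (eigenspace $\mathbb R\xi$) and $\pm\tilde\lambda$ (each of multiplicity $n$); $\mathcal D_{\tilde h}(\pm\tilde\lambda)$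 denote the $\pm\tilde\lambda$-eigendistributions, and the index is that of the restriction of $\tilde g$. *)

(* Defs.v *)
From HB Require Import structures.
From mathcomp Require Import all_boot all_order all_algebra.
From mathcomp Require Import all_classical all_reals all_analysis.
From mathcomp Require Import ring.
Set Implicit Arguments.
Unset Strict Implicit.
Unset Printing Implicit Defensive.
Import Order.TTheory GRing.Theory Num.Theory.
Import numFieldNormedType.Exports.
Local Open Scope classical_set_scope.
Local Open Scope ring_scope.

Section EuclideanSmoothness.
Variables (R : realType) (m : nat).
Implicit Types (f g : 'rV[R]_m -> R) (U : set 'rV[R]_m).

(* Only meaningful for open U: the partial derivatives at x depend on the
   values of f in a neighbourhood of x. *)
Fixpoint Ck (k : nat) U f : Prop :=
  (forall x, U x -> {for x, continuous f}) /\
  if k is k'.+1 then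
    forall i : 'I_m,
      (forall x, U x -> derivable f x (delta_mx 0 i)) /\
      Ck k' U (fun x => 'D_(delta_mx 0 i) f x)
  else True.

Definition smooth_on U f : Prop := forall k, Ck k U f.

Lemma Ck_cont k U f : Ck k U f -> forall x, U x -> {for x, continuous f}.
Proof. by case: k => [|k] []. Qed.

Lemma CkW k U f : Ck k.+1 U f -> Ck k U f.
Proof.
elim: k f => [|k IH] f [cf df]; first by split.
by split=> // i; case: (df i) => dfi /IH.
Qed.

Lemma Ck_ext k U f g : open U -> (forall x, U x -> f x = g x) ->
  Ck k U f -> Ck k U g.
Proof.
move=> oU; elim: k f g => [|k IH] f g fg [cf df].
all: have nfg x : U x -> {near x, f =1 g}
  by move=> Ux; have := open_nbhs_nbhs (conj oU Ux); apply: filterS.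
all: have cg x : U x -> {for x, continuous g}.
1,3: move=> Ux; rewrite /prop_for /continuous_at -(fg _ Ux).
1,2: by have := cf _ Ux; apply: cvg_trans; apply: (near_eq_cvg (nfg _ Ux)).
  by split.
split=> [//|i].
case: (df i) => dfi Cfi; split=> [x Ux|].
  by apply: near_eq_derivable (dfi _ Ux); exact: nfg.
by apply: IH Cfi => x Ux; apply: near_eq_derive; exact: nfg.
Qed.

Lemma Ck_cst k U (a : R) : open U -> Ck k U (cst a).
Proof.
move=> oU; elim: k a => [|k IH] a; split=> //; try by move=> x _; exact: cst_continuous.
move=> i; split=> [x _|]; first exact: derivable_cst.
apply: (@Ck_ext k U (cst 0)) => // x _.
exact: esym (derive_cst _ _ _).
Qed.

Lemma CkD k U f g : open U -> Ck k U f -> Ck k U g -> Ck k U (f + g).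
Proof.
move=> oU; elim: k f g => [|k IH] f g [cf df] [cg dg].
  by split=> // x Ux; exact: (cvgD (cf _ Ux) (cg _ Ux)).
split=> [x Ux|i]; first by exact: (cvgD (cf _ Ux) (cg _ Ux)).
case: (df i) => dfi Cfi; case: (dg i) => dgi Cgi; split=> [x Ux|].
  by apply: derivableD; [exact: dfi|exact: dgi].
apply: (Ck_ext oU _ (IH _ _ Cfi Cgi)) => x Ux.
by rewrite deriveD //; [exact: dfi|exact: dgi].
Qed.

Lemma CkM k U f g : open U -> Ck k U f -> Ck k U g -> Ck k U (f * g).
Proof.
move=> oU; elim: k f g => [|k IH] f g Cf Cg.
  by split=> // x Ux; exact: (cvgM (Cf.1 _ Ux) (Cg.1 _ Ux)).
have [cf df] := Cf; have [cg dg] := Cg.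
split=> [x Ux|i]; first by exact: (cvgM (cf _ Ux) (cg _ Ux)).
case: (df i) => dfi Cfi; case: (dg i) => dgi Cgi; split=> [x Ux|].
  by apply: derivableM; [exact: dfi|exact: dgi].
have C1 := CkD oU (IH _ _ (CkW Cf) Cgi) (IH _ _ (CkW Cg) Cfi).
apply: (Ck_ext oU _ C1) => x Ux.
by rewrite deriveM //; [exact: dfi|exact: dgi].
Qed.

End EuclideanSmoothness.

Record chart (R : realType) (m : nat) (M : topologicalType) := Chart {
  chart_dom : set M;
  chart_map : M -> 'rV[R]_m;
  chart_inv : 'rV[R]_m -> M;
  chart_dom_open : open chart_dom;
  chart_img_open : open (chart_map @` chart_dom);
  chart_mapK : forall p, chart_dom p -> chart_inv (chart_map p) = p;
  chart_map_cont : forall p, chart_dom p -> {for p, continuous chart_map};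
  chart_inv_cont : forall x, (chart_map @` chart_dom) x ->
    {for x, continuous chart_inv}
}.

(* The atlas need not be maximal: the smooth functions below are the same for
   an atlas and for the maximal atlas containing it. *)
Record manifold (R : realType) (m : nat) := Manifold {
  mcarrier :> topologicalType;
  manifold_hausdorff : hausdorff_space mcarrier;
  manifold_second_countable : @second_countable mcarrier;
  atlas : set (chart R m mcarrier);
  atlas_cover : forall p : mcarrier, exists2 c, atlas c & chart_dom c p;
  atlas_compat : forall c c', atlas c -> atlas c' -> forall j : 'I_m,
    smooth_on (chart_map c @` (chart_dom c `&` chart_dom c'))
      (fun x => chart_map c' (chart_inv c x) 0 j)
}.

Section SmoothFunctions.
Variables (R : realType) (m : nat) (M : manifold R m).

Definition is_smooth (f : M -> R) : Prop := forall c, atlas c ->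
  smooth_on (chart_map c @` chart_dom c) (f \o chart_inv c).

Definition smoothp : pred (M -> R) := [pred f | `[< is_smooth f >]].

Lemma smooth_cst (a : R) : cst a \in smoothp.
Proof. by apply/asboolP => c _ k; apply: Ck_cst; exact: chart_img_open. Qed.

Lemma smooth_subring : GRing.subring_closed smoothp.
Proof.
split; first exact: (smooth_cst 1).
- move=> f g /asboolP sf /asboolP sg; apply/asboolP => c Ac k.
  have oU := @chart_img_open _ _ _ c.
  have -> : (f - g) \o chart_inv c =
      (f \o chart_inv c) + cst (-1) * (g \o chart_inv c).
    by apply/funext => x /=; rewrite !fctE mulN1r.
  apply: CkD => //; first exact: sf.
  by apply: CkM => //; [exact: Ck_cst|exact: sg].
- move=> f g /asboolP sf /asboolP sg; apply/asboolP => c Ac k.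
  exact: (CkM (@chart_img_open _ _ _ c) (sf c Ac k) (sg c Ac k)).
Qed.

HB.instance Definition _ :=
  GRing.isSubringClosed.Build (M -> R) smoothp smooth_subring.

Record smooth_fun := SmoothFun {
  smooth_val :> M -> R;
  smooth_valP : smooth_val \in smoothp }.

HB.instance Definition _ := [isSub of smooth_fun for smooth_val].
HB.instance Definition _ := [Choice of smooth_fun by <:].
HB.instance Definition _ :=
  GRing.SubChoice_isSubComPzRing.Build (M -> R) smoothp smooth_fun
    smooth_subring.

Definition csmooth (a : R) : smooth_fun := SmoothFun (smooth_cst a).

End SmoothFunctions.

Section VectorFields.
Variables (R : realType) (m : nat) (M : manifold R m).
Local Notation A := (smooth_fun M).

(* R-linearity follows: csmooth a * f is sent to csmooth a * X f. *)
Definition is_derivation (X : A -> A) : Prop :=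
  [/\ forall f g, X (f + g) = X f + X g,
      forall f g, X (f * g) = f * X g + g * X f &
      forall a : R, X (csmooth M a) = 0].

Definition derp : pred (A -> A^o) := [pred X | `[< is_derivation X >]].

Lemma der_submod : GRing.submod_closed derp.
Proof.
split.
  by apply/asboolP; split=> * /=; rewrite -?[RHS]/(_ * 0 + _ * 0 : A) -?[RHS]/(0 + 0 : A) ?mulr0 ?addr0.
move=> a X Y /asboolP[XD XM X0] /asboolP[YD YM Y0]; apply/asboolP; split.
- by move=> f g; rewrite !fctE XD YD scalerDr addrACA.
- move=> f g; rewrite !fctE XM YM /GRing.scale /= !mulrDr.
  by rewrite !(mulrCA a) addrACA.
- by move=> c; rewrite !fctE X0 Y0 scaler0 addr0.
Qed.

HB.instance Definition _ :=
  GRing.isSubmodClosed.Build A (A -> A^o) derp der_submod.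

(* Smooth vector fields, as derivations of the algebra of smooth functions. *)
Record vector_field := VectorField {
  vf_val :> A -> A^o;
  vf_valP : vf_val \in derp }.

HB.instance Definition _ := [isSub of vector_field for vf_val].
HB.instance Definition _ := [Choice of vector_field by <:].
HB.instance Definition _ := [SubChoice_isSubLmodule of vector_field by <:].

Lemma lie_subproof (X Y : vector_field) :
  ((fun f => X (Y f) - Y (X f)) : A -> A^o) \in derp.
Proof.
have /asboolP[XD XM X0] := vf_valP X; have /asboolP[YD YM Y0] := vf_valP Y.
have XZ : X 0 = 0 by apply: (addrI (X 0)); rewrite -XD !addr0.
have YZ : Y 0 = 0 by apply: (addrI (Y 0)); rewrite -YD !addr0.
apply/asboolP; split.
- by move=> f g; rewrite XD YD XD YD opprD addrACA.
- by move=> f g; rewrite XM YM XD YD !XM !YM; ring.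
- by move=> c; rewrite X0 Y0 XZ YZ subrr.
Qed.

Definition lie (X Y : vector_field) : vector_field :=
  VectorField (lie_subproof X Y).

End VectorFields.

(* Tensor fields are C^oo(M)-multilinear maps on vector fields, and the
   connection is an operator on vector fields. *)
Section Geometry.
Variables (R : realType) (m : nat) (M : manifold R m).
Local Notation A := (smooth_fun M).
Local Notation VF := (vector_field M).
Local Notation "a %:S" := (csmooth M a) (at level 2, format "a %:S").
Implicit Types (X Y Z : VF) (p : M).

(* The tangent vector X_p, as the derivation f |-> (X f)(p) at p.  Every tangent
   vector at p is of this form, since it extends to a global vector field. *)
Definition at_pt p X : A -> R := fun f => X f p.

Definition has_dim (V : lmodType R) (E : set V) (k : nat) : Prop :=
  exists e : 'I_k -> V,
    [/\ forall i, E (e i),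
        forall c : 'I_k -> R, \sum_i c i *: e i = 0 -> forall i, c i = 0 &
        forall v, E v -> exists c : 'I_k -> R, v = \sum_i c i *: e i].

(* A distribution D is given by the sets D p of all vector fields whose value
   at p lies in the subspace at p; that subspace is at_pt p @` D p. *)
Definition distribution := M -> set VF.

Definition sections (D : distribution) : set VF :=
  [set X | forall p, D p X].

Definition has_rank (D : distribution) (k : nat) : Prop :=
  forall p, has_dim (at_pt p @` D p) k.

Definition tangent_dist : distribution := fun=> setT.

Definition ker_dist (eta : VF -> A) : distribution :=
  fun p => [set X | eta X p = 0].

Definition eigen_dist (T : VF -> VF) (c : R) : distribution :=
  fun p => [set X | at_pt p (T X) = c *: at_pt p X].

Definition capD (D E : distribution) : distribution := fun p => D p `&` E p.

Definition neg_definite_family (g : VF -> VF -> A) (D : distribution) p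
    (k : nat) (e : 'I_k -> VF) : Prop :=
  (forall i, D p (e i)) /\
  forall c : 'I_k -> R, (exists i, c i != 0) ->
    let X := \sum_i (c i)%:S *: e i in g X X p < 0.

(* The index of the restriction of g_p to the fibre of D at p is k. *)
Definition index_at (g : VF -> VF -> A) (D : distribution) p (k : nat) : Prop :=
  (exists e : 'I_k -> VF, neg_definite_family g D p e) /\
  forall j (e : 'I_j -> VF), neg_definite_family g D p e -> (j <= k)%N.

Definition constant_index (g : VF -> VF -> A) (D : distribution) : Prop :=
  exists k, forall p, index_at g D p k.

Definition pseudo_riemannian (g : VF -> VF -> A) : Prop :=
  [/\ forall X Y, g X Y = g Y X,
      forall (a : A) X Y Z, g (a *: X + Y) Z = a * g X Z + g Y Z,
      forall p X, (forall Y, g X Y p = 0) -> at_pt p X = 0 &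
      constant_index g tangent_dist].

Definition is_connection (nabla : VF -> VF -> VF) : Prop :=
  [/\ forall (a : A) X Y Z, nabla (a *: X + Y) Z = a *: nabla X Z + nabla Y Z,
      forall X Y Z, nabla X (Y + Z) = nabla X Y + nabla X Z &
      forall (a : A) X Y, nabla X (a *: Y) = X a *: Y + a *: nabla X Y].

Definition levi_civita (g : VF -> VF -> A) (nabla : VF -> VF -> VF) : Prop :=
  [/\ is_connection nabla,
      forall X Y, nabla X Y - nabla Y X = lie X Y &
      forall X Y Z, X (g Y Z) = g (nabla X Y) Z + g Y (nabla X Z)].

Definition curvature (nabla : VF -> VF -> VF) X Y Z : VF :=
  nabla X (nabla Y Z) - nabla Y (nabla X Z) - nabla (lie X Y) Z.

Definition dform (eta : VF -> A) X Y : A :=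
  2^-1%:S * (X (eta Y) - Y (eta X) - eta (lie X Y)).

Definition lie_endo (xi : VF) (T : VF -> VF) X : VF :=
  lie xi (T X) - T (lie xi X).

Definition para_h (phi : VF -> VF) (xi : VF) X : VF :=
  2^-1%:S *: lie_endo xi phi X.

End Geometry.

Notation "a %:S" := (csmooth _ a) (at level 2, format "a %:S") : ring_scope.

Section Paracontact.
Variables (R : realType) (n : nat) (M : manifold R n.*2.+1).
Local Notation A := (smooth_fun M).
Local Notation VF := (vector_field M).
Variables (phi : {linear VF -> VF}) (xi : VF) (eta : {scalar VF}).

Definition almost_paracontact : Prop :=
  [/\ eta xi = 1,
      forall X : VF, phi (phi X) = X - eta X *: xi,
      has_rank (capD (ker_dist eta) (eigen_dist phi 1)) n &
      has_rank (capD (ker_dist eta) (eigen_dist phi (-1))) n].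

Definition paracontact_metric (g : VF -> VF -> A) : Prop :=
  [/\ almost_paracontact,
      pseudo_riemannian g,
      forall X Y : VF, g (phi X) (phi Y) = - g X Y + eta X * eta Y &
      forall X Y : VF, dform eta X Y = g X (phi Y)].

(* nabla is bound to be the Levi-Civita connection of g. *)
Definition paracontact_kappa_mu (g : VF -> VF -> A) (nabla : VF -> VF -> VF)
    (kappa mu : R) : Prop :=
  [/\ paracontact_metric g,
      levi_civita g nabla &
      forall X Y : VF, curvature nabla X Y xi =
        kappa%:S *: (eta Y *: X - eta X *: Y) +
        mu%:S *: (eta Y *: para_h phi xi X - eta X *: para_h phi xi Y)].

End Paracontact.

(* Main.v *)
Require Import Defs.
From HB Require Import structures.
From mathcomp Require Import all_boot all_order all_algebra.
From mathcomp Require Import all_classical all_reals all_analysis.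
From mathcomp Require Import ring.
Set Implicit Arguments.
Unset Strict Implicit.
Unset Printing Implicit Defensive.
Import Order.TTheory GRing.Theory Num.Theory.
Local Open Scope ring_scope.

(** The Levi-Civita connection of a paracontact (kappa, mu)-manifold with
    kappa <> -1 differs by an explicit tensor from a metric connection D for
    which the whole structure is parallel; the curvature of D is then so
    constrained that the first Bianchi identity determines it.

    Write [nabla_X xi = - phi X + S X].  Since [g (-, phi -)] is [d eta], the
    endomorphism S is symmetric, and the closedness of [d eta] gives
    [nabla_xi phi = 0], [S phi = - phi S] and [h = phi S] ([phi_parallel_xi],
    [S_phi], [para_hE]).  Putting [xi] into the nullity condition and separating
    the parts that commute and anticommute with [phi] yields
    [S^2 = - (1 + kappa) phi^2] and [nabla_xi S = - mu phi S] ([S_S],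
    [nabla_xi_S]).

    Let [D_X Y = nabla_X Y - eta(Y) nabla_X xi + g(nabla_X xi, Y) xi
    + (mu / 2) eta(X) phi Y].  Then xi, eta and g are D-parallel, and the two
    tensors [g((D_X phi) Y, Z)] and [g((D_X S) Y, Z)] vanish as soon as one
    argument is [xi].  The remaining nullity condition is a Codazzi equation
    tying them together; combined with the symmetries that come from
    [d (d eta) = 0], [phi^2 = 1], [phi S + S phi = 0] and
    [S^2 = - (1 + kappa)] on the contact distribution, it forces both to vanish
    when [1 + kappa] is invertible ([D_phi_eq0], [D_S_eq0]).  This is where
    kappa <> -1 is needed.

    Hence the curvature RD of D commutes with [phi] and [S].  Let kappa > -1, so
    that lambda is real and nonzero; then RD preserves each eigendistribution of
    [h].  For X, X' in the lambda-eigendistribution and Y in the other one, the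
    component of the Bianchi identity in the latter gives [RD X X' Y]
    explicitly, and its component in the former says that [RD X Y X'] is
    symmetric in X and X'.  As [g (RD X Y X') X''] is also skew in X' and X'',
    it vanishes ([RD_cyclic_split], [RD_mixed]).  Going back to nabla gives
    three of the six formulas; the other three follow because the argument only
    uses [lambda^2 = 1 + kappa], hence also applies to - lambda. *)

(** * Smooth functions and vector fields *)

(** With [ring] closing the second premise, this proves an equation from a
    linear combination of known ones. *)
Lemma lincomb (V : zmodType) (a b l r : V) : l = r -> a - b = l - r -> a = b.
Proof. by move=> -> ab; apply: subr0_eq; rewrite ab subrr. Qed.

Lemma lincombD (V : zmodType) (l r l' r' : V) :
  l = r -> l' = r' -> l + l' = r + r'.
Proof. by move=> -> ->. Qed.

Lemma half_half (R : realType) : 2^-1 + 2^-1 = 1 :> R.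
Proof. by rewrite [RHS]splitr mul1r. Qed.

Section Calculus.
Variables (R : realType) (m : nat) (M : manifold R m).
Local Notation A := (smooth_fun M).
Local Notation VF := (vector_field M).
Implicit Types (X Y Z : VF) (f : A).

Lemma csmooth_zmod_morphism : zmod_morphism (csmooth M).
Proof. by move=> a b; apply/val_inj/funext. Qed.

Lemma csmooth_monoid_morphism : monoid_morphism (csmooth M).
Proof. by split=> [|a b]; apply/val_inj/funext. Qed.

HB.instance Definition _ :=
  GRing.isZmodMorphism.Build R A (csmooth M) csmooth_zmod_morphism.
HB.instance Definition _ :=
  GRing.isMonoidMorphism.Build R A (csmooth M) csmooth_monoid_morphism.

Lemma csmooth_inj_mul (a : R) f : a != 0 -> a%:S * f = 0 -> f = 0.
Proof.
move=> a0 /(congr1 ( *%R a^-1%:S)).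
by rewrite mulr0 mulrA -rmorphM mulVf // rmorph1 mul1r.
Qed.

Lemma double_eq0 f : f + f = 0 -> f = 0.
Proof.
move=> ff; apply: (@csmooth_inj_mul 2); first by rewrite pnatr_eq0.
by rewrite rmorphD rmorph1 mulrDl mul1r.
Qed.

Lemma vf_ext X Y : (forall f, X f = Y f) -> X = Y.
Proof. by move=> XY; apply/val_inj/funext. Qed.

Lemma half_vfK X : 2^-1%:S *: (X + X) = X.
Proof. by rewrite scalerDr -scalerDl -rmorphD half_half rmorph1 scale1r. Qed.

Lemma vf_double_eq0 X : X + X = 0 -> X = 0.
Proof. by move=> XX; rewrite -[X]half_vfK XX scaler0. Qed.

Lemma vfD X f h : X (f + h) = X f + X h.
Proof. by have /asboolP[] := vf_valP X. Qed.

Lemma vf_cst X a : X a%:S = 0.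
Proof. by have /asboolP[] := vf_valP X. Qed.

Lemma vf0 X : X 0 = 0.
Proof. by apply: (addrI (X 0)); rewrite -vfD !addr0. Qed.

Lemma vfN X f : X (- f) = - X f.
Proof. by apply: (addrI (X f)); rewrite -vfD !subrr vf0. Qed.

Lemma add_vfE X Y f : (X + Y) f = X f + Y f. Proof. by []. Qed.
Lemma scale_vfE (a : A) X f : (a *: X) f = a * X f. Proof. by []. Qed.
Lemma opp_vfE X f : (- X) f = - X f. Proof. by []. Qed.
Lemma zero_vfE f : (0 : VF) f = 0. Proof. by []. Qed.
Lemma lieE X Y f : (lie X Y) f = X (Y f) - Y (X f). Proof. by []. Qed.

Definition vfE := (add_vfE, scale_vfE, opp_vfE, zero_vfE).

Lemma lie_jacobi X Y Z :
  lie X (lie Y Z) + lie Y (lie Z X) + lie Z (lie X Y) = 0.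
Proof. by apply: vf_ext => f; rewrite !(vfE, lieE, vfD, vfN); ring. Qed.

Lemma lieC X Y : lie Y X = - lie X Y.
Proof. by apply: vf_ext => f; rewrite !(vfE, lieE); ring. Qed.

Lemma linD (F : {linear VF -> VF}) X Y : F (X + Y) = F X + F Y.
Proof. exact: linearD. Qed.

Lemma linN (F : {linear VF -> VF}) X : F (- X) = - F X.
Proof. exact: linearN. Qed.

Lemma linZ (F : {linear VF -> VF}) (a : A) X : F (a *: X) = a *: F X.
Proof. exact: linearZ. Qed.

Definition linE F := (linD F, linN F, linZ F).

(** The same argument proves the uniqueness of the Levi-Civita connection: the
    transposition of the first two arguments and that of the last two are
    conjugate, so they cannot act on a nonzero form with different signs. *)
Lemma sym_skew_eq0 (T : Type) (F : T -> T -> T -> A) :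
    (forall x y z, F x y z = F y x z) ->
    (forall x y z, F x y z = - F x z y) ->
  forall x y z, F x y z = 0.
Proof.
move=> sym skew x y z; apply: double_eq0.
rewrite {1}[F x y z]skew [F x z y]sym [F z x y]skew [F z y x]sym.
by rewrite [F y z x]skew [F y x z]sym opprK addNr.
Qed.

End Calculus.

(** A module identity between vector fields becomes a ring identity once both
    sides are applied to an arbitrary function. *)
Ltac vring := apply: vf_ext => ?; rewrite !vfE; ring.

(** * Connections and metrics *)

(** The covariant derivative of an endomorphism field.  It is locked because
    unification would otherwise see the difference in its body and rewrite with
    the additivity of [g] inside it. *)
HB.lock Definition cov (R : realType) (m : nat) (M : manifold R m)
    (D : vector_field M -> vector_field M -> vector_field M)
    (F : vector_field M -> vector_field M) (X Y : vector_field M) :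
  vector_field M := D X (F Y) - F (D X Y).
Arguments cov {R m M} D F X Y.

Section Connection.
Variables (R : realType) (m : nat) (M : manifold R m).
Local Notation A := (smooth_fun M).
Local Notation VF := (vector_field M).
Implicit Types (X Y Z W : VF) (F : {linear VF -> VF}).
Variable D : VF -> VF -> VF.

Lemma covE (F : VF -> VF) X Y : cov D F X Y = D X (F Y) - F (D X Y).
Proof. by rewrite unlock. Qed.

Hypothesis conD : is_connection D.

Lemma connDl X Y Z : D (X + Y) Z = D X Z + D Y Z.
Proof. by case: conD => H _ _; rewrite -[X]scale1r H !scale1r. Qed.

Lemma conn0l Z : D 0 Z = 0.
Proof. by apply: (addrI (D 0 Z)); rewrite -connDl !addr0. Qed.

Lemma connZl (a : A) X Z : D (a *: X) Z = a *: D X Z.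
Proof. by case: conD => H _ _; rewrite -[_ *: X]addr0 H conn0l addr0. Qed.

Lemma connNl X Z : D (- X) Z = - D X Z.
Proof. by rewrite -scaleN1r connZl scaleN1r. Qed.

Lemma connDr X Y Z : D X (Y + Z) = D X Y + D X Z.
Proof. by case: conD. Qed.

Lemma connZr (a : A) X Y : D X (a *: Y) = X a *: Y + a *: D X Y.
Proof. by case: conD. Qed.

Lemma conn0r X : D X 0 = 0.
Proof. by apply: (addrI (D X 0)); rewrite -connDr !addr0. Qed.

Lemma connNr X Y : D X (- Y) = - D X Y.
Proof. by apply: (addrI (D X Y)); rewrite -connDr !subrr conn0r. Qed.

Definition connE :=
  (connDl, connZl, connNl, conn0l, connDr, connZr, connNr, conn0r).

Lemma covDl F X Y Z : cov D F (X + Y) Z = cov D F X Z + cov D F Y Z.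
Proof. by rewrite !covE !connDl linearD; vring. Qed.

Lemma covZl F (a : A) X Z : cov D F (a *: X) Z = a *: cov D F X Z.
Proof. by rewrite !covE !connZl linearZ -scalerBr. Qed.

Lemma curvatureC X Y Z : curvature D X Y Z = - curvature D Y X Z.
Proof. by rewrite /curvature (lieC X Y) !connE; vring. Qed.

Lemma curvature_parallel F X Y Z :
  (forall W W', D W (F W') = F (D W W')) ->
  curvature D X Y (F Z) = F (curvature D X Y Z).
Proof. by move=> DF; rewrite /curvature !DF !linearB. Qed.

Lemma curvature_cst (a : R) X Y Z :
  curvature D X Y (a%:S *: Z) = a%:S *: curvature D X Y Z.
Proof.
by rewrite /curvature !(vf_cst, vf0, scale0r, add0r, connE); vring.
Qed.

(** First Bianchi identity: the torsion-free condition turns the cyclic sum of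
    curvatures into the Jacobi identity. *)
Lemma bianchi X Y Z : (forall X Y, D X Y - D Y X = lie X Y) ->
  curvature D X Y Z + curvature D Y Z X + curvature D Z X Y = 0.
Proof.
move=> tor; rewrite -(lie_jacobi X Y Z) /curvature -!tor.
by rewrite !connE; vring.
Qed.

End Connection.

Section Metric.
Variables (R : realType) (m : nat) (M : manifold R m).
Local Notation A := (smooth_fun M).
Local Notation VF := (vector_field M).
Implicit Types (X Y Z W : VF) (f : A).
Variable g : VF -> VF -> A.
Hypothesis riem : pseudo_riemannian g.

Lemma gC X Y : g X Y = g Y X.
Proof. by case: riem. Qed.

Lemma gDl X Y Z : g (X + Y) Z = g X Z + g Y Z.
Proof. by case: riem => _ H _ _; rewrite -[X]scale1r H mul1r scale1r. Qed.

Lemma g0l Y : g 0 Y = 0.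
Proof. by apply: (addrI (g 0 Y)); rewrite -gDl !addr0. Qed.

Lemma gZl (a : A) X Y : g (a *: X) Y = a * g X Y.
Proof. by case: riem => _ H _ _; rewrite -[_ *: _]addr0 H g0l addr0. Qed.

Lemma gNl X Y : g (- X) Y = - g X Y.
Proof. by rewrite -scaleN1r gZl mulN1r. Qed.

Lemma gDr X Y Z : g X (Y + Z) = g X Y + g X Z.
Proof. by rewrite gC gDl !(gC X). Qed.

Lemma g0r X : g X 0 = 0.
Proof. by rewrite gC g0l. Qed.

Lemma gZr (a : A) X Y : g X (a *: Y) = a * g X Y.
Proof. by rewrite gC gZl (gC X). Qed.

Lemma gNr X Y : g X (- Y) = - g X Y.
Proof. by rewrite gC gNl (gC X). Qed.

Definition gE := (gDl, gDr, gZl, gZr, gNl, gNr, g0l, g0r).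

Lemma g_inj X Y : (forall Z, g X Z = g Y Z) -> X = Y.
Proof.
move=> XY; apply: subr0_eq; apply: vf_ext => f; apply/val_inj/funext => p.
case: riem => _ _ nondeg _.
apply: (congr1 (@^~ f) (nondeg p (X - Y) _)) => Z.
by rewrite gDl gNl XY subrr.
Qed.

Lemma g_eq0 X : (forall Z, g X Z = 0) -> X = 0.
Proof. by move=> X0; apply: g_inj => Z; rewrite X0 g0l. Qed.

Variable D : VF -> VF -> VF.
Hypothesis Dg : forall X Y Z, X (g Y Z) = g (D X Y) Z + g Y (D X Z).

(** Apply [lie X Y = X Y - Y X] to the function [g Z W]. *)
Lemma curvature_skew X Y Z W :
  g (curvature D X Y Z) W = - g Z (curvature D X Y W).
Proof.
have := lieE X Y (g Z W); rewrite !Dg !vfD !Dg => E.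
by apply: (lincomb (esym E)); rewrite /curvature !gE; ring.
Qed.

End Metric.

(** Every tensor of the structure is parallel for this connection when
    [c = mu / 2].  The terms in [xi] make [xi] parallel while keeping the
    connection metric; the last one makes [S] parallel in the direction of
    [xi].  Locked for the same reason as [cov]. *)
HB.lock Definition canonical_connection (R : realType) (m : nat)
    (M : manifold R m) (phi : vector_field M -> vector_field M)
    (xi : vector_field M) (eta : vector_field M -> smooth_fun M)
    (g : vector_field M -> vector_field M -> smooth_fun M)
    (nabla : vector_field M -> vector_field M -> vector_field M)
    (c : smooth_fun M) (X Y : vector_field M) : vector_field M :=
  nabla X Y - eta Y *: nabla X xi + g (nabla X xi) Y *: xi
  + (c * eta X) *: phi Y.

(** * Paracontact metric structures *)

Section ParacontactMetric.
Variables (R : realType) (n : nat) (M : manifold R n.*2.+1).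
Local Notation A := (smooth_fun M).
Local Notation VF := (vector_field M).
Implicit Types (X Y Z W : VF) (f : A).
Variables (phi : {linear VF -> VF}) (xi : VF) (eta : {scalar VF}).
Variables (g : VF -> VF -> A) (nabla : VF -> VF -> VF).
Hypothesis pcm : paracontact_metric phi xi eta g.
Hypothesis lc : levi_civita g nabla.

Let riem : pseudo_riemannian g. Proof. by case: pcm. Qed.
Let con : is_connection nabla. Proof. by case: lc. Qed.
Let gE := gE riem.
Let gC := gC riem.
Let conE := connE con.
Let phiE := linE phi.

Lemma etaD X Y : eta (X + Y) = eta X + eta Y. Proof. exact: linearD. Qed.
Lemma etaN X : eta (- X) = - eta X. Proof. exact: linearN. Qed.
Lemma etaZ (a : A) X : eta (a *: X) = a * eta X. Proof. exact: linearZ. Qed.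
Let etaE := (etaD, etaN, etaZ).

Let dg X Y Z : X (g Y Z) = g (nabla X Y) Z + g Y (nabla X Z).
Proof. by case: lc. Qed.

Let torsion_free X Y : nabla X Y - nabla Y X = lie X Y.
Proof. by case: lc. Qed.

Lemma eta_xi : eta xi = 1.
Proof. by case: pcm => -[]. Qed.

Lemma phi_phi X : phi (phi X) = X - eta X *: xi.
Proof. by case: pcm => -[]. Qed.

Lemma g_phi X Y : g (phi X) (phi Y) = - g X Y + eta X * eta Y.
Proof. by case: pcm. Qed.

Lemma d_eta X Y :
  X (eta Y) - Y (eta X) - eta (lie X Y) = g X (phi Y) + g X (phi Y).
Proof.
case: pcm => _ _ _ /(_ X Y) <-.
by rewrite /dform -mulrDl -rmorphD half_half rmorph1 mul1r.
Qed.

Lemma phi_skew X Y : g (phi X) Y = - g X (phi Y).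
Proof.
apply: subr0_eq; rewrite opprK gC; apply: double_eq0.
have := d_eta X Y; have := d_eta Y X; rewrite (lieC X Y) etaN => E1 E2.
by apply: (lincomb (esym (lincombD E1 E2))); ring.
Qed.

Lemma phi_phi_xi : phi (phi xi) = 0.
Proof. by rewrite phi_phi eta_xi scale1r subrr. Qed.

(** Since [phi] is skew and [phi^2 xi = 0], the left-hand side of the
    compatibility condition [g_phi] vanishes at the pair xi, Y. *)
Lemma g_xi Y : g xi Y = eta Y.
Proof.
have := g_phi xi Y; rewrite eta_xi mul1r -[g (phi xi) _]opprK -phi_skew.
by rewrite phi_phi_xi gE oppr0 => E; apply: (lincomb E); ring.
Qed.

Lemma g_xir Y : g Y xi = eta Y.
Proof. by rewrite gC g_xi. Qed.

Lemma phi_xi : phi xi = 0.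
Proof.
have /subr0_eq -> : phi xi - eta (phi xi) *: xi = 0.
  by rewrite -phi_phi phi_phi_xi linear0.
rewrite (_ : eta (phi xi) = 0) ?scale0r // -g_xi; apply: double_eq0.
by rewrite -{1}[g xi _]opprK -phi_skew [g (phi xi) _]gC addNr.
Qed.

Lemma eta_phi X : eta (phi X) = 0.
Proof. by rewrite -g_xi -[g xi _]opprK -phi_skew phi_xi gE oppr0. Qed.

(** The endomorphism [S] is [phi h] for [h = para_h phi xi] (see [para_hE]);
    working with [S] rather than [h] makes the covariant derivative of [xi]
    linear in the basic tensors from the start. *)
Local Notation P X := (nabla X xi).
Variable S : {linear VF -> VF}.
Hypothesis nabla_xiE : forall X, P X = - phi X + S X.
Let SE := linE S.

Let S_def X : S X = P X + phi X.
Proof. by rewrite nabla_xiE; vring. Qed.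

Lemma eta_P X : eta (P X) = 0.
Proof.
apply: double_eq0; have := dg X xi xi.
by rewrite !g_xir !g_xi eta_xi -(rmorph1 (csmooth M)) vf_cst.
Qed.

Lemma nabla_eta X Y : X (eta Y) = g (P X) Y + eta (nabla X Y).
Proof. by rewrite -!g_xi dg. Qed.

Lemma P_skew X Y : g (P X) Y - g X (P Y) = g X (phi Y) + g X (phi Y).
Proof.
by rewrite -d_eta !nabla_eta -torsion_free !etaE (gC X (P Y)); ring.
Qed.

Lemma P_xi : P xi = 0.
Proof.
apply: (g_inj riem) => Y; have := P_skew xi Y.
by rewrite !g_xi eta_P eta_phi addr0 subr0 gE.
Qed.

Lemma S_sym X Y : g (S X) Y = g X (S Y).
Proof.
by apply: (lincomb (P_skew X Y)); rewrite !S_def !gE phi_skew; ring.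
Qed.

Lemma S_xi : S xi = 0.
Proof. by rewrite S_def P_xi phi_xi addr0. Qed.

Lemma eta_S X : eta (S X) = 0.
Proof. by rewrite S_def etaD eta_P eta_phi addr0. Qed.

Lemma cov_phi_xi X : cov nabla phi X xi = - phi (P X).
Proof. by rewrite covE phi_xi !conE sub0r. Qed.

Lemma cov_phi_phi X Y : cov nabla phi X (phi Y) + phi (cov nabla phi X Y) =
  - (g (P X) Y *: xi) - eta Y *: P X.
Proof. by rewrite !covE !phiE !phi_phi !conE nabla_eta; vring. Qed.

Lemma cov_phi_skew X Y Z :
  g (cov nabla phi X Y) Z = - g Y (cov nabla phi X Z).
Proof.
have := dg X (phi Y) Z; rewrite phi_skew vfN dg => E.
by apply: (lincomb (esym E)); rewrite !covE !gE !phi_skew; ring.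
Qed.

(** The 2-form [g (-, phi -)] is closed, being [d eta].  Expanding [d eta] by
    means of [nabla xi], its exterior derivative is the cyclic sum of
    [g (curvature X Y xi) Z], which vanishes by the Bianchi identity. *)
Lemma cov_phi_cyclic X Y Z :
  g (cov nabla phi X Y) Z + g (cov nabla phi Y Z) X
  + g (cov nabla phi Z X) Y = 0.
Proof.
apply: double_eq0.
have E U V W : g U (cov nabla phi V W) + g U (cov nabla phi V W) =
   g (nabla V (P U) - nabla (nabla V U) xi) W
   - g (nabla V (P W) - nabla (nabla V W) xi) U.
  have := congr1 (vf_val V) (P_skew U W).
  have E1 := P_skew (nabla V U) W; have E2 := P_skew U (nabla V W).
  rewrite !vfD vfN !dg => E0.
  apply: (lincomb (esym (lincombD E0 (lincombD (esym E2) (esym E1))))).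
  by rewrite !covE !gE (gC U (nabla V (P W))) (gC U (P (nabla V W))); ring.
have R0 : g (curvature nabla X Y xi) Z + g (curvature nabla Y Z xi) X +
    g (curvature nabla Z X xi) Y = 0.
  rewrite !(curvature_skew riem dg) !g_xi -!opprD -!etaD.
  by rewrite (bianchi con) // linear0 oppr0.
rewrite (cov_phi_skew X Y) (cov_phi_skew Y Z) (cov_phi_skew Z X).
have := lincombD (lincombD (E Y X Z) (E Z Y X)) (lincombD (E X Z Y) R0).
rewrite /curvature -!torsion_free !conE !gE => E'.
by apply: (lincomb (esym E')); ring.
Qed.

Lemma cov_xi_phi X : cov nabla phi xi X = - (phi (S X) + S (phi X)).
Proof.
apply: (g_inj riem) => Z.
have := cov_phi_cyclic xi X Z.
rewrite (cov_phi_skew X Z xi) !cov_phi_xi !nabla_xiE => E.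
apply: (lincomb E); rewrite !phiE !gE.
by rewrite (phi_skew (phi Z)) (phi_skew Z) (phi_skew (S Z)) (S_sym Z) !(gC Z);
  ring.
Qed.

(** By [cov_xi_phi] the derivative of [phi] along [xi] is [- (phi S + S phi)],
    which commutes with [phi] because [phi^2] acts as the identity on the image
    of [S].  It also anticommutes with [phi], as [phi^2 = 1 - eta xi] is
    constant along [xi].  Hence it is zero. *)
Lemma S_phi X : S (phi X) = - phi (S X).
Proof.
have := cov_phi_phi xi X.
rewrite !cov_xi_phi !P_xi !gE !(SE, phiE, phi_phi) S_xi eta_S => E.
have /vf_double_eq0 : phi (S (phi X)) + S X + (phi (S (phi X)) + S X) = 0.
  by apply: (lincomb (esym E)); vring.
move=> /(congr1 phi); rewrite phiE phi_phi linear0 eta_S => E'.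
by apply: (lincomb E'); vring.
Qed.

Lemma phi_parallel_xi X : nabla xi (phi X) = phi (nabla xi X).
Proof.
apply: subr0_eq; rewrite -(covE nabla phi) cov_xi_phi S_phi.
by rewrite subrr oppr0.
Qed.

Lemma para_hE X : para_h phi xi X = phi (S X).
Proof.
rewrite /para_h /lie_endo -!torsion_free !nabla_xiE phi_parallel_xi !phiE S_phi.
by rewrite -[RHS]half_vfK; congr (_ *: _); vring.
Qed.

(** * The nullity condition *)

Variables kappa mu : R.
Hypothesis nullity : forall X Y, curvature nabla X Y xi =
  kappa%:S *: (eta Y *: X - eta X *: Y) +
  mu%:S *: (eta Y *: phi (S X) - eta X *: phi (S Y)).

Let k := kappa%:S : A.
Let c := (2^-1 * mu)%:S : A.

Let muE : mu%:S = c + c.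
Proof. by rewrite -rmorphD -mulrDl half_half mul1r. Qed.

Lemma P_P X : P (P X) = phi (phi X) + S (S X).
Proof. by rewrite !nabla_xiE !(phiE, SE) S_phi; vring. Qed.

(** [curvature nabla xi X xi] is the derivative of [nabla xi] along [xi] plus
    its square; compare with the nullity condition. *)
Lemma nullity_xi X :
  nabla xi (S X) - S (nabla xi X) + S (S X) + (1 + k) *: phi (phi X)
    + mu%:S *: phi (S X) = 0.
Proof.
have := nullity xi X; rewrite /curvature -torsion_free P_xi S_xi linear0 !conE.
rewrite P_P eta_xi nabla_xiE !conE phi_parallel_xi nabla_xiE => E.
by apply: (lincomb E); rewrite phi_phi -/k; vring.
Qed.

(** In [nullity_xi] the derivative of [S] and [phi S] anticommute with [phi]
    while [S^2] and [phi^2] commute with it, so both parts vanish. *)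
Lemma S_S X : S (S X) = - (1 + k) *: phi (phi X).
Proof.
have E1 := congr1 phi (nullity_xi X); have := nullity_xi (phi X).
rewrite phi_parallel_xi !S_phi !SE !S_phi !conE phi_parallel_xi !phiE => E2.
move: E1; rewrite !phiE linear0 => E1.
suff : phi (S (S X)) + (1 + k) *: phi (phi (phi X)) = 0.
  move=> /(congr1 phi); rewrite linear0 !(phiE, phi_phi) eta_S eta_phi phi_xi.
  by move=> E; apply: (lincomb E); vring.
by apply: vf_double_eq0; apply: (lincomb (lincombD E1 E2)); vring.
Qed.

Lemma nabla_xi_S X : nabla xi (S X) = S (nabla xi X) - mu%:S *: phi (S X).
Proof. by apply: (lincomb (nullity_xi X)); rewrite S_S; vring. Qed.

(** * The canonical connection *)

Local Notation D := (canonical_connection phi xi eta g nabla c).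

Let D_def X Y : D X Y =
  nabla X Y - eta Y *: P X + g (P X) Y *: xi + (c * eta X) *: phi Y.
Proof. by rewrite unlock. Qed.

Lemma D_connection : is_connection D.
Proof.
by split=> [a X Y Z|X Y Z|a X Y]; rewrite !D_def !conE !(gE, etaE, phiE); vring.
Qed.
Let DE := connE D_connection.

Lemma D_xi X : D X xi = 0.
Proof. by rewrite D_def g_xir eta_P eta_xi phi_xi; vring. Qed.

Lemma D_metric X Y Z : X (g Y Z) = g (D X Y) Z + g Y (D X Z).
Proof.
by rewrite dg !D_def !gE !g_xi !g_xir phi_skew (gC _ (P X)); ring.
Qed.

Lemma D_eta X Y : X (eta Y) = eta (D X Y).
Proof. by rewrite -!g_xir D_metric D_xi gE addr0. Qed.

Lemma D_xil Y : D xi Y = nabla xi Y + c *: phi Y.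
Proof. by rewrite D_def P_xi eta_xi gE; vring. Qed.

Lemma D_torsion X Y : eta X = 0 -> eta Y = 0 ->
  D X Y - D Y X = lie X Y + (g X (phi Y) + g X (phi Y)) *: xi.
Proof.
by move=> X0 Y0; rewrite -P_skew -torsion_free !D_def X0 Y0 (gC X); vring.
Qed.

Local Notation Dphi := (cov D phi).
Local Notation DS := (cov D S).

Lemma Dphi_xil Y : Dphi xi Y = 0.
Proof. by rewrite covE !D_xil phi_parallel_xi !phiE; vring. Qed.

Lemma DS_xil Y : DS xi Y = 0.
Proof. by rewrite covE !D_xil nabla_xi_S !SE S_phi muE; vring. Qed.

Lemma Dphi_xir X : Dphi X xi = 0.
Proof. by rewrite covE phi_xi D_xi !DE linear0 subrr. Qed.

Lemma Dphi_phi X Y : Dphi X (phi Y) = - phi (Dphi X Y).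
Proof.
apply: subr0_eq; rewrite opprK !covE !phiE !phi_phi !DE D_xi D_eta.
by vring.
Qed.

Lemma Dphi_skew X Y Z : g (Dphi X Y) Z = - g (Dphi X Z) Y.
Proof.
have := D_metric X (phi Y) Z; rewrite phi_skew vfN D_metric => E.
apply: (lincomb (esym E)); rewrite (gC (Dphi X Z)).
by rewrite !covE !gE !phi_skew; ring.
Qed.

Lemma DS_sym X Y Z : g (DS X Y) Z = g (DS X Z) Y.
Proof.
have := D_metric X (S Y) Z; rewrite S_sym D_metric => E.
by apply: (lincomb (esym E)); rewrite (gC (DS X Z)) !covE !gE !S_sym; ring.
Qed.

Lemma DS_phi X Y :
  DS X (phi Y) + S (Dphi X Y) = - (Dphi X (S Y) + phi (DS X Y)).
Proof. by rewrite !covE S_phi !(DE, phiE, SE) S_phi; vring. Qed.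

Lemma DS_S X Y : DS X (S Y) = - S (DS X Y).
Proof.
apply: subr0_eq; rewrite opprK !covE !SE !S_S !phi_phi !DE D_xi D_eta.
by rewrite -(rmorph1 (csmooth M)) -rmorphD -rmorphN vf_cst; vring.
Qed.

Lemma Dphi_nabla X Y : Dphi X Y =
  cov nabla phi X Y + g (P X) (phi Y) *: xi + eta Y *: phi (P X).
Proof. by rewrite !covE !D_def !phiE eta_phi phi_xi; vring. Qed.

(** The corrections in [Dphi_nabla] cancel in the cyclic sum because
    [phi (nabla xi)] is a symmetric endomorphism. *)
Lemma Dphi_cyclic X Y Z :
  g (Dphi X Y) Z + g (Dphi Y Z) X + g (Dphi Z X) Y = 0.
Proof.
apply: (lincomb (cov_phi_cyclic X Y Z)).
have P_phi V W : g (P V) (phi W) = - g (phi V) (phi W) - g (phi (S V)) W.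
  by rewrite nabla_xiE !gE (phi_skew (S V)); ring.
have phi_P V W : g (phi (P V)) W = - g (P V) (phi W) by rewrite phi_skew.
have phiS_sym V W : g (phi (S V)) W = g (phi (S W)) V.
  by rewrite phi_skew S_sym S_phi gE opprK gC.
rewrite !Dphi_nabla !gE !g_xi !phi_P !P_phi.
rewrite (phiS_sym Y X) (phiS_sym Z X) (phiS_sym Z Y).
by rewrite (gC (phi Y) (phi X)) (gC (phi Z) (phi X)) (gC (phi Z) (phi Y)); ring.
Qed.

Lemma D_P X Y : DS X Y - Dphi X Y =
  nabla X (P Y) - P (nabla X Y) + g (P X) (P Y) *: xi
  + (mu%:S * eta X) *: phi (S Y) - (k * eta Y) *: phi (phi X).
Proof.
have E : DS X Y - Dphi X Y = D X (P Y) - P (D X Y).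
  by rewrite !covE !nabla_xiE !DE; vring.
have P_phi : P (phi Y) = - phi (phi Y) - phi (S Y).
  by rewrite nabla_xiE S_phi.
have phi_P : phi (P Y) = - phi (phi Y) + phi (S Y) by rewrite nabla_xiE !phiE.
by rewrite E !D_def eta_P !conE P_xi P_phi phi_P P_P S_S muE -/k; vring.
Qed.

(** The nullity condition says exactly that the D-derivative of
    [nabla xi = - phi + S] is a Codazzi tensor. *)
Lemma codazzi X Y : DS X Y - Dphi X Y = DS Y X - Dphi Y X.
Proof.
have := nullity X Y; rewrite /curvature -torsion_free conE => E.
by apply: (lincomb E); rewrite !D_P (gC (P Y)) conE !phi_phi -/k; vring.
Qed.

(** * The structure tensors are parallel *)

Lemma eta_Dphi X Y : eta (Dphi X Y) = 0.
Proof. by rewrite -g_xir Dphi_skew Dphi_xir gE oppr0. Qed.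

Lemma g_Dphi_phi X Y Z : g (Dphi X (phi Y)) Z = g (Dphi X Y) (phi Z).
Proof. by rewrite Dphi_phi gE phi_skew opprK. Qed.

Lemma g_Dphi_phi_phi X Y Z : g (Dphi X Y) (phi (phi Z)) = g (Dphi X Y) Z.
Proof. by rewrite phi_phi !gE g_xir eta_Dphi mulr0 subr0. Qed.

Lemma DphiNl X Y : Dphi (- X) Y = - Dphi X Y.
Proof. by rewrite -scaleN1r (covZl D_connection) scaleN1r. Qed.

Lemma Dphi_phi_phil X Y : Dphi (phi (phi X)) Y = Dphi X Y.
Proof.
rewrite phi_phi (covDl D_connection) DphiNl (covZl D_connection) Dphi_xil.
by vring.
Qed.

(** The difference of the two sides is symmetric in X and Y by [Dphi_cyclic],
    and skew in Y and Z. *)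
Lemma g_Dphi_phil_phi X Y Z : g (Dphi (phi X) (phi Y)) Z = g (Dphi X Y) Z.
Proof.
apply: esym; apply: subr0_eq.
pose F U V W := g (Dphi U V) W - g (Dphi (phi U) (phi V)) W.
apply: (@sym_skew_eq0 _ _ M _ F) => {}X {}Y {}Z; rewrite /F.
- have E1 := Dphi_cyclic X Y Z; have E2 := Dphi_cyclic (phi X) (phi Y) Z.
  rewrite (g_Dphi_phi Z) g_Dphi_phi_phi (Dphi_skew (phi Y)) in E2.
  rewrite (Dphi_skew Y) in E1.
  by apply: (lincomb (lincombD E1 (esym E2))); ring.
- rewrite (Dphi_skew X Z) (g_Dphi_phi (phi X) Z).
  by rewrite (Dphi_skew (phi X) Z (phi Y)); ring.
Qed.

Lemma g_Dphi_phil X Y Z : g (Dphi (phi X) Y) Z = g (Dphi X (phi Y)) Z.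
Proof. by rewrite -(g_Dphi_phil_phi X) !g_Dphi_phi g_Dphi_phi_phi. Qed.

Lemma g_Dphi_DS X Y Z : g (Dphi Z X) Y = g (DS Y X) Z - g (DS X Y) Z.
Proof.
have E := Dphi_cyclic X Y Z; rewrite (Dphi_skew Y) in E.
have := congr1 (g^~ Z) (codazzi X Y); rewrite /= !gE => E'.
by apply: (lincomb (lincombD E E')); ring.
Qed.

Lemma g_DS_phi X Y Z : g (DS X (phi Y)) Z =
  g (DS X Y) (phi Z) - g (Dphi X Y) (S Z) - g (Dphi X (S Y)) Z.
Proof.
have := congr1 (g^~ Z) (DS_phi X Y); rewrite /= !gE S_sym phi_skew => E.
by apply: (lincomb E); ring.
Qed.

Lemma g_DS_phil X Y Z : g (DS (phi X) Y) Z =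
  g (DS X Y) (phi Z) - g (Dphi Y X) (S Z) - g (Dphi Y (S X)) Z.
Proof.
have E1 := g_Dphi_DS (phi X) Y Z; have E2 := g_Dphi_DS X Y (phi Z).
rewrite g_DS_phi -g_Dphi_phil E2 in E1.
by apply: (lincomb E1); ring.
Qed.

(** The left-hand side of [g_DS_phil] is symmetric in Y and Z; the DS-terms of
    the resulting equation cancel, and what remains is this relation. *)
Lemma Dphi_S_cyclic X Y Z :
  g (Dphi (S X) Y) Z + g (Dphi (S Y) Z) X + g (Dphi (S Z) X) Y = 0.
Proof.
have := DS_sym (phi X) Y Z.
rewrite !g_DS_phil -(DS_sym X (phi Y) Z) g_DS_phi => E.
have Ec := lincombD (Dphi_cyclic (S X) Y Z)
  (lincombD (Dphi_cyclic (S Y) Z X) (Dphi_cyclic (S Z) X Y)).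
rewrite (Dphi_skew Y X) (Dphi_skew Y (S X)) in E.
by apply: (lincomb (lincombD Ec (esym E))); ring.
Qed.

(** Replacing X by [phi X] in [Dphi_S_cyclic] changes the sign of only one
    term, since [phi] moves freely between the arguments but anticommutes with
    [S].  Adding two of the three relations obtained in this way leaves twice a
    single term. *)
Lemma g_Dphi_phiS X Y Z : g (Dphi (phi (S X)) Y) Z = 0.
Proof.
pose H U V W := g (Dphi (phi (S U)) V) W.
have E U V W : - H U V W + H V W U + H W U V = 0.
  rewrite -(Dphi_S_cyclic (phi U) V W) S_phi DphiNl gE /H.
  by rewrite (g_Dphi_phil (S W)) -(g_Dphi_phi (S V)) -(g_Dphi_phil (S V)).
apply: double_eq0.
by apply: (lincomb (lincombD (E Y Z X) (E Z X Y))); rewrite /H; ring.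
Qed.

Hypothesis kappa1_neq0 : 1 + kappa != 0.

Lemma kappa1_inj f : (1 + k) * f = 0 -> f = 0.
Proof. by rewrite -(rmorph1 (csmooth M)) -rmorphD; exact: csmooth_inj_mul. Qed.

Lemma D_phi_eq0 X Y : Dphi X Y = 0.
Proof.
apply: (g_eq0 riem) => Z; apply: kappa1_inj.
rewrite -(g_Dphi_phiS (phi (S X)) Y Z) S_phi !phiE phi_phi eta_S scale0r subr0.
by rewrite S_S DphiNl (covZl D_connection) Dphi_phi_phil !gE mulNr opprK.
Qed.

Lemma DS_symm X Y Z : g (DS X Y) Z = g (DS Y X) Z.
Proof.
apply: subr0_eq.
by rewrite -opprB -g_Dphi_DS D_phi_eq0 (g0l riem) oppr0.
Qed.

Lemma g_DS_S X Y Z : g (DS X (S Y)) Z = - g (DS X Y) (S Z).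
Proof. by rewrite DS_S gE S_sym. Qed.

(** The trilinear form [g (DS X Y) Z] is totally symmetric, and moving [S] from
    one argument to another changes its sign; moving it around the three
    arguments gives back the opposite. *)
Lemma g_DS_Sl X Y Z : g (DS (S X) Y) Z = 0.
Proof.
have sym12 U V W : g (DS (S U) V) W = g (DS (S V) U) W.
  by rewrite (DS_symm _ V) g_DS_S (DS_symm V) -g_DS_S (DS_symm U).
have skew : g (DS (S X) Y) Z = - g (DS (S X) Y) Z.
  rewrite {1}(DS_symm _ Y) g_DS_S (DS_sym Y) (DS_symm Y) sym12 (DS_sym (S Y)).
  by rewrite (sym12 Y).
by apply: double_eq0; rewrite {1}skew addNr.
Qed.

Lemma D_S_eq0 X Y : DS X Y = 0.
Proof.
apply: (g_eq0 riem) => Z; apply: kappa1_inj.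
have := g_DS_Sl (S X) Y Z; rewrite S_S phi_phi -scaleNr.
rewrite (covZl D_connection) (covDl D_connection) (covZl D_connection).
rewrite DS_xil scaler0 addr0 gE => E.
by apply: (lincomb (esym E)); ring.
Qed.

Lemma D_phi X Y : D X (phi Y) = phi (D X Y).
Proof. by have := D_phi_eq0 X Y; rewrite covE => /subr0_eq. Qed.

Lemma D_S X Y : D X (S Y) = S (D X Y).
Proof. by have := D_S_eq0 X Y; rewrite covE => /subr0_eq. Qed.

(** * Curvature of the canonical connection *)

Local Notation RD := (curvature D).

Lemma RD_phi X Y Z : RD X Y (phi Z) = phi (RD X Y Z).
Proof. by apply: curvature_parallel D_phi. Qed.

Lemma RD_S X Y Z : RD X Y (S Z) = S (RD X Y Z).
Proof. by apply: curvature_parallel D_S. Qed.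

Lemma RD_skew X Y Z W : g (RD X Y Z) W = - g Z (RD X Y W).
Proof. exact: (curvature_skew riem D_metric). Qed.

Lemma eta_RD X Y Z : eta (RD X Y Z) = 0.
Proof. by rewrite -g_xir RD_skew /curvature !(D_xi, DE) !subr0 gE oppr0. Qed.

(** As the tensor [D - nabla] is D-parallel, the two curvatures differ only by
    its commutator and by its value on the torsion of D. *)
Lemma curvature_RD X Y Z : eta X = 0 -> eta Y = 0 -> eta Z = 0 ->
  curvature nabla X Y Z = RD X Y Z - g (P Y) Z *: P X + g (P X) Z *: P Y
    - (mu%:S * g X (phi Y)) *: phi Z.
Proof.
move=> X0 Y0 Z0.
have nabla_D U V : nabla U V =
    D U V + eta V *: P U - g (P U) V *: xi - (c * eta U) *: phi V.
  by rewrite D_def; vring.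
have DP U V : D U (P V) = P (D U V) by rewrite !nabla_xiE !DE D_phi D_S.
have eta_lie : eta (lie X Y) = - (g X (phi Y) + g X (phi Y)).
  by rewrite -d_eta X0 Y0 !vf0; ring.
have P_lie : P (lie X Y) = P (D X Y) - P (D Y X).
  have := congr1 (nabla^~ xi) (D_torsion X0 Y0).
  by rewrite !conE P_xi scaler0 addr0.
have eta_DZ V : eta (D V Z) = 0 by rewrite -D_eta Z0 vf0.
have step V W : eta V = 0 -> eta W = 0 ->
    nabla V (nabla W Z) = D V (D W Z) - g (P W) Z *: P V
    - (g (P V) (D W Z) + g (P (D V W)) Z + g (P W) (D V Z)) *: xi.
  move=> V0 W0.
  rewrite (nabla_D W) W0 Z0 !conE D_metric DP (nabla_D V (D W Z)) eta_DZ V0.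
  by rewrite mulr0 !vf0 !scale0r; vring.
rewrite /curvature (step X Y) // (step Y X) // (nabla_D (lie X Y)) P_lie.
by rewrite eta_lie Z0 muE !gE; vring.
Qed.

(** * The eigendistributions *)

Section Eigen.
Variable l : R.
Hypothesis l_neq0 : l != 0.
Hypothesis l_sqr : l * l = 1 + kappa.

(** For nonzero [a] this is [phi (S X) = a X], that is [h X = a X]. *)
Definition eig (a : R) X := S X = a%:S *: phi X /\ eta X = 0.

Let kE : k = l%:S * l%:S - 1.
Proof. by rewrite -rmorphM l_sqr rmorphD rmorph1; ring. Qed.

Lemma eig_P a X : eig a X -> P X = (a%:S - 1) *: phi X.
Proof. by case=> SX _; rewrite nabla_xiE SX; vring. Qed.

Lemma eig_phi a X : eig a X -> eig (- a) (phi X).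
Proof.
by case=> SX _; split; rewrite ?eta_phi // S_phi SX phiE rmorphN scaleNr.
Qed.

Lemma eigD a X Y : eig a X -> eig a Y -> eig a (X + Y).
Proof.
case=> SX X0 [SY Y0]; split; last by rewrite etaD X0 Y0 addr0.
by rewrite !(SE, phiE) SX SY; vring.
Qed.

Lemma eigZ a (b : A) X : eig a X -> eig a (b *: X).
Proof.
case=> SX X0; split; last by rewrite etaZ X0 mulr0.
by rewrite !(SE, phiE) SX; vring.
Qed.

Lemma eig_RD a X Y Z : eig a Z -> eig a (RD X Y Z).
Proof.
case=> SZ Z0; split; last exact: eta_RD.
by rewrite -RD_S SZ (curvature_cst D_connection) RD_phi.
Qed.

Lemma l2_inj f : (l%:S + l%:S) * f = 0 -> f = 0.
Proof. by rewrite mulrDl => /double_eq0; exact: csmooth_inj_mul. Qed.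

(** X and Y are eigenvectors of the symmetric endomorphism [phi S] for distinct
    eigenvalues. *)
Lemma eig_orth X Y : eig l X -> eig (- l) Y -> g X Y = 0.
Proof.
case=> SX X0 [SY Y0]; apply: l2_inj.
have phiSX : phi (S X) = l%:S *: X.
  by rewrite SX phiE phi_phi X0 scale0r subr0.
have phiSY : phi (S Y) = - l%:S *: Y.
  by rewrite SY phiE phi_phi Y0 scale0r subr0 rmorphN.
have : g (phi (S X)) Y = g X (phi (S Y)).
  by rewrite phi_skew S_sym S_phi gE opprK.
by rewrite phiSX phiSY !gE => E; apply: (lincomb E); ring.
Qed.

Lemma eig_disjoint X : eig l X -> eig (- l) X -> X = 0.
Proof.
case=> SX X0 [SX' _].
have phiX : phi X = 0.
  apply: (g_eq0 riem) => Z; apply: l2_inj.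
  have E : l%:S *: phi X = (- l)%:S *: phi X by rewrite -SX.
  have := congr1 (g^~ Z) E; rewrite /= !gE rmorphN => {}E.
  by apply: (lincomb E); ring.
by have := phi_phi X; rewrite phiX linear0 X0 scale0r subr0.
Qed.

(** The eigendistribution is nondegenerate: [l phi^2 + phi S] maps every field
    into it, and is self-adjoint with value 2 l on it. *)
Lemma eig_nondeg X : eig l X -> (forall Y, eig l Y -> g X Y = 0) -> X = 0.
Proof.
move=> [SX X0] X_orth; apply: (g_eq0 riem) => Z; apply: l2_inj.
have eY : eig l (l%:S *: phi (phi Z) + phi (S Z)).
  split; last by rewrite etaD etaZ !eta_phi; ring.
  by rewrite !(SE, phiE, S_phi) S_S kE !(phiE, phi_phi) eta_S; vring.
have gXS : g X (phi (S Z)) = l%:S * g X Z.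
  rewrite -[LHS]opprK -phi_skew -S_sym S_phi SX phiE phi_phi X0 scale0r subr0.
  by rewrite !gE opprK.
have := X_orth _ eY; rewrite !gE gXS phi_phi !gE g_xir X0 => E.
by apply: (lincomb E); ring.
Qed.

Let g_phi_eig X Y : eig l X -> eig l Y -> g (phi X) Y = 0.
Proof. by move=> eX eY; rewrite gC; apply: eig_orth => //; exact: eig_phi. Qed.

Let lmuE : (2 * (l - 1) + mu)%:S = (l%:S - 1) + (l%:S - 1) + mu%:S :> A.
Proof.
by rewrite mulr_natl mulr2n -(rmorph1 (csmooth M)) -!rmorphB -!rmorphD.
Qed.

Section Bianchi.
Variables X X' Y : VF.
Hypotheses (eX : eig l X) (eX' : eig l X') (eY : eig (- l) Y).

Let B := - g (phi X') Y *: phi X + g (phi X) Y *: phi X'.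

Lemma RD_bianchi :
  RD X X' Y + (RD X' Y X + RD Y X X') = (2 * (l - 1) + mu)%:S *: B.
Proof.
have [[_ X0] [_ X0'] [_ Y0]] := And3 eX eX' eY.
have Bi := bianchi con X X' Y torsion_free.
rewrite !curvature_RD // in Bi.
have phiY V : g (phi Y) V = - g (phi V) Y by rewrite phi_skew gC.
have X'phi : g X' (phi Y) = - g (phi X') Y by rewrite phi_skew opprK.
rewrite (eig_P eX) (eig_P eX') (eig_P eY) !gE !phiY X'phi in Bi.
rewrite (gC Y (phi X)) (gC X (phi X')) in Bi.
rewrite (g_phi_eig eX eX') (g_phi_eig eX' eX) in Bi.
by apply: (lincomb Bi); rewrite /B lmuE rmorphN; vring.
Qed.

(** In [RD_bianchi] the first term and the right-hand side lie in the
    eigendistribution of - l, the other two terms in that of l. *)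
Lemma RD_cyclic_split :
  RD X X' Y = (2 * (l - 1) + mu)%:S *: B /\ RD X' Y X + RD Y X X' = 0.
Proof.
have eB : eig (- l) B by apply: eigD; apply/eigZ/eig_phi.
have sum0 : RD X' Y X + RD Y X X' = 0.
  apply: eig_disjoint; first by apply: eigD; exact: eig_RD.
  have -> : RD X' Y X + RD Y X X' =
      (2 * (l - 1) + mu)%:S *: B + (-1) *: RD X X' Y.
    by rewrite -RD_bianchi; vring.
  by apply: eigD; apply: eigZ => //; exact: eig_RD.
by split=> //; rewrite -RD_bianchi sum0 addr0.
Qed.

End Bianchi.

Lemma RD_mixed X Y X' : eig l X -> eig (- l) Y -> eig l X' -> RD X Y X' = 0.
Proof.
move=> eX eY eX'; apply: eig_nondeg => [|X'' eX'']; first exact: eig_RD.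
pose F (x y z : {Z | eig l Z}) := g (RD (sval x) Y (sval y)) (sval z).
apply: (@sym_skew_eq0 _ _ M _ F _ _
  (exist _ X eX) (exist _ X' eX') (exist _ X'' eX'')).
- move=> [x ex] [y ey] [z ez]; rewrite /F /=.
  have [_] := RD_cyclic_split ex ey eY.
  by rewrite (curvatureC D_connection Y x) => /subr0_eq ->.
- by move=> [x ex] [y ey] [z ez]; rewrite /F /= RD_skew gC.
Qed.

Lemma curvature_eig X X' X'' Y :
  eig l X -> eig l X' -> eig l X'' -> eig (- l) Y ->
  [/\ curvature nabla X X' X'' =
        (2 * (l - 1) + mu)%:S *: (g X' X'' *: X - g X X'' *: X'),
      curvature nabla X X' Y = (kappa + mu)%:S *:
        (- g (phi X') Y *: phi X + g (phi X) Y *: phi X') &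
      curvature nabla X Y X' = (kappa%:S * g (phi Y) X') *: phi X
        - (mu%:S * g (phi Y) X) *: phi X'].
Proof.
move=> eX eX' eX'' eY.
have [[_ X0] [_ X0']] := (eX, eX'); have [[_ X0''] [_ Y0]] := (eX'', eY).
have phiY V : g (phi Y) V = - g (phi V) Y by rewrite phi_skew gC.
have kmuE : (kappa + mu)%:S = l%:S * l%:S - 1 + mu%:S :> A.
  by rewrite -kE -rmorphD.
split; rewrite curvature_RD // !(eig_P eX, eig_P eX', eig_P eY) !gE.
- (* [phi X''] lies in the other eigendistribution, where RD X X' is known *)
  have [RDphi _] := RD_cyclic_split eX eX' (eig_phi eX'').
  have := congr1 phi RDphi; rewrite RD_phi phi_phi eta_RD scale0r subr0 => ->.
  rewrite (gC X (phi X')) (g_phi_eig eX' eX'') (g_phi_eig eX eX'').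
  by rewrite (g_phi_eig eX' eX) !(phiE, g_phi, phi_phi) X0 X0' X0''; vring.
- have [-> _] := RD_cyclic_split eX eX' eY.
  by rewrite (gC X (phi X')) (g_phi_eig eX' eX) kmuE lmuE; vring.
- rewrite RD_mixed // (g_phi_eig eX eX') (gC X (phi Y)) !phiY.
  by rewrite -/k kE rmorphN; vring.
Qed.

End Eigen.

Lemma eig_section (l : R) X : l != 0 ->
  sections (eigen_dist (para_h phi xi) l) X -> eig l X.
Proof.
move=> l0 sX.
have hX : phi (S X) = l%:S *: X.
  rewrite -para_hE; apply: vf_ext => f; apply/val_inj/funext => p.
  exact: (congr1 (@^~ f) (sX p)).
split; last by apply: (csmooth_inj_mul l0); rewrite -etaZ -hX eta_phi.
by rewrite -phiE -hX phi_phi eta_S scale0r subr0.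
Qed.

End ParacontactMetric.

Theorem theorem4p11 (R : realType) (n : nat) (M : manifold R n.*2.+1)
    (phi : {linear vector_field M -> vector_field M}) (xi : vector_field M)
    (eta : {scalar vector_field M})
    (g : vector_field M -> vector_field M -> smooth_fun M)
    (nabla : vector_field M -> vector_field M -> vector_field M)
    (kappa mu : R) :
  paracontact_kappa_mu phi xi eta g nabla kappa mu ->
  -1 < kappa ->
  let lambda := Num.sqrt (1 + kappa) in
  let Dplus := eigen_dist (para_h phi xi) lambda in
  let Dminus := eigen_dist (para_h phi xi) (- lambda) in
  let Rc := curvature nabla in
  constant_index g Dplus ->
  constant_index g Dminus ->
  forall X X' X'' Y Y' Y'' : vector_field M,
  sections Dplus X -> sections Dplus X' -> sections Dplus X'' ->
  sections Dminus Y -> sections Dminus Y' -> sections Dminus Y'' ->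
  Rc X X' X'' =
    (2 * (lambda - 1) + mu)%:S *: (g X' X'' *: X - g X X'' *: X') /\
  Rc X X' Y =
    (kappa + mu)%:S *:
      (- g (phi X') Y *: phi X + g (phi X) Y *: phi X') /\
  Rc X Y X' =
    (kappa%:S * g (phi Y) X') *: phi X - (mu%:S * g (phi Y) X) *: phi X' /\
  Rc X Y Y' =
    - (kappa%:S * g (phi X) Y') *: phi Y + (mu%:S * g (phi X) Y) *: phi Y' /\
  Rc Y Y' X =
    (kappa + mu)%:S *:
      (- g (phi Y') X *: phi Y + g (phi Y) X *: phi Y') /\
  Rc Y Y' Y'' =
    (- (2 * (lambda + 1)) + mu)%:S *: (g Y' Y'' *: Y - g Y Y'' *: Y').
Proof.
move=> [pcm lc nul] kappa_gt lambda Dplus Dminus Rc _ _ X X' X'' Y Y' Y''.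
move=> sX sX' sX'' sY sY' sY''.
have con : is_connection nabla by case: lc.
have S_linear : linear (fun V => nabla V xi + phi V).
  by move=> a V W; rewrite (connDl con) (connZl con) linearP; vring.
pose S : {linear vector_field M -> vector_field M} :=
  HB.pack (fun V => nabla V xi + phi V)
    (GRing.isLinear.Build _ _ _ _ _ S_linear).
have nabla_xiE V : nabla V xi = - phi V + S V by rewrite /S /=; vring.
have nullity V W : curvature nabla V W xi =
    kappa%:S *: (eta W *: V - eta V *: W) +
    mu%:S *: (eta W *: phi (S V) - eta V *: phi (S W)).
  by rewrite nul !(para_hE pcm lc nabla_xiE).
have kappa1_gt0 : 0 < 1 + kappa by rewrite -ltrBlDl sub0r.
have l_sqr : lambda * lambda = 1 + kappa by rewrite -expr2 sqr_sqrtr // ltW.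
have l_neq0 : lambda != 0 by rewrite gt_eqF // sqrtr_gt0.
have nl_sqr : - lambda * - lambda = 1 + kappa by rewrite mulrNN.
have nl_neq0 : - lambda != 0 by rewrite oppr_eq0.
have eigP := eig_section pcm lc nabla_xiE l_neq0.
have eigN := eig_section pcm lc nabla_xiE nl_neq0.
have curv l :=
  @curvature_eig _ _ _ _ _ _ _ _ pcm lc _ nabla_xiE _ _ nullity
    (lt0r_neq0 kappa1_gt0) l.
have [F1 F2 F3] := curv _ l_neq0 l_sqr _ _ _ _
  (eigP _ sX) (eigP _ sX') (eigP _ sX'') (eigN _ sY).
have eXN : eig phi eta S (- - lambda) X by rewrite opprK; exact: eigP.
have [E1 E2 E3] := curv _ nl_neq0 nl_sqr _ _ _ _
  (eigN _ sY) (eigN _ sY') (eigN _ sY'') eXN.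
do 3!split=> //; split; first by rewrite /Rc (curvatureC con) E3; vring.
by split=> //; rewrite /Rc E1; congr (_%:S *: _); ring.
Qed.
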